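(* Let $K=\{z:|\operatorname{Re}z|+|\operatorname{Im}z|\le1\}$ and let $$K_1=\{z\in K:|z-\tfrac{-1+i}{2}|\le\tfrac1{\sqrt2},\ |z-\tfrac{-1-i}{2}|\le\tfrac1{\sqrt2}\},$$ $$K_2=\{z\in K:|z-\tfrac{-1+i}{2}|\le\tfrac1{\sqrt2},\ |z-\tfrac{-1-i}{2}|\ge\tfrac1{\sqrt2},\ |z-\tfrac{1+i}{2}|\ge\tfrac1{\sqrt2}\},$$ $$K_j=-i\,K_{j-2}\quad\text{for }j=3,\dots,8.$$ Writing $B(c)$ for the open disk of radius $1$ centered at $c$ and $\overline{\mathbb{C}}=\mathbb{C}\cup\{\infty\}$, define $$L_1=\overline{\mathbb{C}}\setminus\big(B(0)\cup B(-1+i)\cup B(-1-i)\big),\qquad L_2=\overline{\mathbb{C}}\setminus\big(B(0)\cup B(-1+i)\big),$$ $$L_j=-i\,L_{j-2}\quad\text{for }j=3,\dots,8.$$ Then the map $\hat G$ for the nearest even algorithm is bijective a.e. on $\bigcup_{j=1}^8K_j\times L_j$.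
   Context: Here $i=\sqrt{-1}$. The nearest even algorithm is the choice function $$\lfloor z\rceil=\left\lfloor\tfrac{\operatorname{Re}z+\operatorname{Im}z+1}{2}\right\rfloor(1+i)+\left\lfloor\tfrac{\operatorname{Re}z-\operatorname{Im}z+1}{2}\right\rfloor(1-i),$$ i.e. the nearest Gaussian integer $x+yi$ with $x+y$ even (with a convention for ties). Its natural extension map is $\hat G(z,w)=(-1/z-a,\,-1/w-a)$ with $a=\lfloor-1/z\rceil$, for $z\in K\setminus\{0\}$ and $w$ in the Riemann sphere. ''Bijective a.e. on $\Omega$'' means that, after removing sets of zero Lebesgue measure (in $\mathbb{C}^2$) from the source and from the target, $\hat G$ restricts to a bijection of $\Omega$ onto $\Omega$. *)

(* Defs.v *)
From HB Require Import structures.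
From mathcomp Require Import all_boot all_order all_algebra.
From mathcomp Require Import all_classical all_reals all_analysis.
From mathcomp Require Import complex.
Set Implicit Arguments.
Unset Strict Implicit.
Unset Printing Implicit Defensive.
Import Order.TTheory GRing.Theory Num.Theory.
Local Open Scope classical_set_scope.
Local Open Scope ring_scope.
Local Open Scope complex_scope.

(* The Riemann sphere: [Some w] is a finite point, [None] is infinity. *)
Notation sphere R := (one_point_compactification R[i]).

Section NearestEven.
Variable R : realType.
Implicit Types (z : R[i]) (w : sphere R).

Definition nearest_even z : R[i] :=
  (Num.floor ((complex.Re z + complex.Im z + 1) / 2))%:~R * (1 + 'i%C)
  + (Num.floor ((complex.Re z - complex.Im z + 1) / 2))%:~R * (1 - 'i%C).

Definition sphere_neg_inv w : sphere R :=
  match w with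
  | None => Some 0
  | Some u => if u == 0 then None else Some (- 1 / u)
  end.

(* Only meaningful for [p.1 != 0]: at [p.1 = 0] the library's [- 1 / 0 = 0]
   makes the value meaningless, so [Ghat] is always paired with [Ghat_dom]. *)
Definition Ghat (p : R[i] * sphere R) : R[i] * sphere R :=
  let a := nearest_even (- 1 / p.1) in
  (- 1 / p.1 - a, omap (fun u => u - a) (sphere_neg_inv p.2)).

Definition Kset : set R[i] :=
  [set z : R[i] | `|complex.Re z| + `|complex.Im z| <= 1].

Definition Ghat_dom : set (R[i] * sphere R) := (Kset `\ 0) `*` setT.

Definition inv_sqrt2 : R[i] := ((Num.sqrt 2)^-1)%:C.

Definition K1 : set R[i] := [set z : R[i] | [/\ Kset z,
  `|z - (- 1 + 'i%C) / 2| <= inv_sqrt2 & `|z - (- 1 - 'i%C) / 2| <= inv_sqrt2]].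

Definition K2 : set R[i] := [set z : R[i] | [/\ Kset z,
  `|z - (- 1 + 'i%C) / 2| <= inv_sqrt2,
  `|z - (- 1 - 'i%C) / 2| >= inv_sqrt2 & `|z - (1 + 'i%C) / 2| >= inv_sqrt2]].

Definition B (c : R[i]) : set R[i] := [set z : R[i] | `|z - c| < 1].

Definition L1 : set (sphere R) :=
  ~` (Some @` (B 0 `|` B (- 1 + 'i%C) `|` B (- 1 - 'i%C))).

Definition L2 : set (sphere R) := ~` (Some @` (B 0 `|` B (- 1 + 'i%C))).

Definition mul_negi z : R[i] := - 'i%C * z.

(* Indices start at 1; the value at [j = 0] is never used. *)
Fixpoint K_ (j : nat) : set R[i] :=
  match j with
  | 0 => set0
  | 1 => K1
  | 2 => K2
  | j'.+2 => mul_negi @` K_ j'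
  end.

Fixpoint L_ (j : nat) : set (sphere R) :=
  match j with
  | 0 => set0
  | 1 => L1
  | 2 => L2
  | j'.+2 => omap mul_negi @` L_ j'
  end.

Definition Omega : set (R[i] * sphere R) :=
  \bigcup_(j in [set j | (1 <= j <= 8)%N]) (K_ j `*` L_ j).

Definition R4 : Type := ((measurableTypeR R * measurableTypeR R)
  * (measurableTypeR R * measurableTypeR R))%type.

HB.instance Definition _ := Measurable.on R4.

Definition lebesgue_C2 : set R4 -> \bar R :=
  ((lebesgue_measure \x lebesgue_measure)
   \x (lebesgue_measure \x lebesgue_measure))%E.

(* Zero Lebesgue measure in C^2, identified with R^4 through real and
   imaginary parts. Points with infinite second coordinate lie outside C^2
   and do not contribute to the measure. *)
Definition null_C2 (N : set (R[i] * sphere R)) : Prop :=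
  negligible lebesgue_C2
    [set p : R4 | N (p.1.1 +i* p.1.2, Some (p.2.1 +i* p.2.2))].

(* The partial map [f] with domain [D] is bijective a.e. on [A]. *)
Definition bijective_ae (D : set (R[i] * sphere R))
    (f : R[i] * sphere R -> R[i] * sphere R) (A : set (R[i] * sphere R)) : Prop :=
  exists N1 N2 : set (R[i] * sphere R),
    [/\ null_C2 N1, null_C2 N2, A `\` N1 `<=` D
      & set_bij (A `\` N1) (A `\` N2) f].

End NearestEven.

(* Main.v *)
(* Call a point of the plane generic when it lies on no circle or line
   [a |z|^2 + b x + c y + d = 0] with integer coefficients, not all zero.  The
   nongeneric points form a null set which is invariant under [z |-> -1/z] and
   under translation by Gaussian integers, so it can serve as exceptional set
   both in the source and in the target; all the boundaries involved lie in it.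
   Write [z.c] for the real scalar product and let [c] range over the four points
   [+-1 +- i].  Generically, [(z, w)] is in Omega iff
     [z.c < 1] for all [c],  [|w| > 1],  and  [|z|^2 < z.c -> |w - c| > 1],
   and [(u, v) = (-1/z, -1/w)] then runs over the pairs such that
     [u.c < |u|^2] for all [c],  [|v| < 1],  and  [u.c > 1 -> |v - c| > 1].
   It remains to see that translation by the nearest even point to [u] is a
   bijection from the second set to the first.  If two even points [a], [a'] give
   the same image, then [v - v' = a - a'] has length less than 2, hence is some
   [c], and the third condition at [c] and at [-c] forces [u.c = 1], which is not
   generic.  Conversely, given [(z, w)] in Omega, let [-a] be an even point at
   distance less than 1 from [w]: either [(z + a, w + a)] is in the second set, or
   its third condition fails at some [c] and [a - c] works. *)
From HB Require Import structures.
Require Import Defs.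
From mathcomp Require Import all_boot all_order all_algebra.
From mathcomp Require Import all_classical all_reals all_analysis.
From mathcomp Require Import measurable_realfun complex.
From mathcomp Require Import ring lra zify.
Set Implicit Arguments.
Unset Strict Implicit.
Unset Printing Implicit Defensive.
Import Order.TTheory GRing.Theory Num.Theory.
Local Open Scope classical_set_scope.
Local Open Scope ring_scope.

(** * Generic points and the null exceptional set *)

Section Genericity.
Variable R : realType.
Implicit Types x y s t : R.

Definition circle_eq (a b c d : int) x y : R :=
  a%:~R * (x ^+ 2 + y ^+ 2) + b%:~R * x + c%:~R * y + d%:~R.

Definition generic x y : Prop :=
  forall a b c d : int, circle_eq a b c d x y = 0 -> [/\ a = 0, b = 0, c = 0 & d = 0].

Definition circle_set (k : int * int * int * int) :
    set (measurableTypeR R * measurableTypeR R) :=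
  [set p | circle_eq k.1.1.1 k.1.1.2 k.1.2 k.2 p.1 p.2 = 0].

Lemma measurable_circle_set k : measurable (circle_set k).
Proof.
case: k => -[[a b] c] d.
rewrite /circle_set /=.
rewrite (_ : mkset _ = setT `&` (fun p : measurableTypeR R * measurableTypeR R =>
  circle_eq a b c d p.1 p.2) @^-1` [set 0]); last by rewrite setTI.
suff /(_ measurableT) mf : measurable_fun setT
    (fun p : measurableTypeR R * measurableTypeR R => circle_eq a b c d p.1 p.2).
  exact: mf.
rewrite /circle_eq.
have m1 := @measurable_fst _ _ (measurableTypeR R) (measurableTypeR R).
have m2 := @measurable_snd _ _ (measurableTypeR R) (measurableTypeR R).
apply: measurable_funD; last exact: measurable_cst.
apply: measurable_funD; last by apply: measurable_funM.
apply: measurable_funD; last by apply: measurable_funM.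
apply: measurable_funM; first exact: measurable_cst.
by apply: measurable_funD; apply: measurable_funX.
Qed.

Lemma quadratic_zeros_countable (a b c : R) : (a, b, c) != 0 ->
  countable [set y : R | a * y ^+ 2 + b * y + c = 0].
Proof.
move=> nz.
have [[y0 /= y0E]|no] := pselect (exists y, a * y ^+ 2 + b * y + c = 0); last first.
  by rewrite (_ : mkset _ = set0) // -subset0 => y /= yE; apply: no; exists y.
(* By Vieta the other root is [- (b / a) - y0]. If [a = 0] this second point is meaningless but
   harmless, since only an inclusion in a finite set is needed. *)
apply: (@sub_countable _ _ _ [set y0; - (b / a) - y0]).
  apply: subset_card_le => y /= yE.
  have /eqP : (y - y0) * (a * (y + y0) + b) = 0 by lra.
  rewrite mulf_eq0 => /orP[/eqP|/eqP h]; first by left; lra.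
  have [a0|a0] := eqVneq a 0; last first.
    right; apply: (mulfI a0); rewrite [RHS](_ : _ = - b - a * y0); first by lra.
    by field.
  exfalso; move: nz; rewrite a0 in h yE *.
  have b0 : b = 0 by lra.
  have c0 : c = 0 by move: yE; rewrite b0; lra.
  by rewrite b0 c0 eqxx.
exact: finite_set_countable.
Qed.

(* The library's canonical sigma-finite instance on [_ \x _] only fires on products
   of subprobabilities, hence a name of its own for the measure of the plane. *)
Definition plane_measure :
    set (measurableTypeR R * measurableTypeR R) -> \bar R :=
  (lebesgue_measure \x lebesgue_measure)%E.

HB.instance Definition _ := Measure.on plane_measure.

HB.instance Definition _ := Measure_isSigmaFinite.Build _ _ _ plane_measure
  (isSigmaFinite.sigma_finiteT
    (lebesgue_integral_fubini.measure_function_Measure_isSigmaFinite__to__measure_function_isSigmaFinite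
      lebesgue_measure lebesgue_measure)).

(** If [a] or [c] is nonzero, each section at fixed [x] is the zero set of a nonzero polynomial in
    [y] of degree at most 2, hence countable, and the measure is the integral of these null
    sections. Otherwise the set is a countable set of abscissas times the line. *)
Lemma circle_set_null k : k != 0 -> plane_measure (circle_set k) = 0%E.
Proof.
have mk := measurable_circle_set k.
case: k mk => -[[a b] c] d mk nz.
have [ac0|ac0] := eqVneq (a, c) 0.
  move: ac0 => [a0 c0]; subst a c.
  rewrite (_ : circle_set _ = [set x : R | 0 * x ^+ 2 + b%:~R * x + d%:~R = 0] `*` setT).
    have cS : countable [set x : R | 0 * x ^+ 2 + b%:~R * x + d%:~R = 0].
      apply: quadratic_zeros_countable.
      apply: contra nz => /eqP[b0 d0].
      move: b0 d0 => /eqP + /eqP; rewrite !intr_eq0 => /eqP -> /eqP ->.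
      by rewrite eqxx.
    rewrite [LHS]product_measure1E //; last exact: countable_measurable.
    by rewrite [X in (X * _)%E]countable_lebesgue_measure0 // mul0e.
  apply/seteqP; split => -[x y] /=; rewrite /circle_set /circle_eq /=
    !mul0r !add0r addr0 //.
  by case.
apply: integral0_eq => x _ /=.
apply: countable_lebesgue_measure0.
rewrite (_ : xsection _ _ = [set y : R | a%:~R * y ^+ 2 + c%:~R * y +
  (a%:~R * x ^+ 2 + b%:~R * x + d%:~R) = 0]).
  apply: quadratic_zeros_countable.
  apply: contra ac0 => /eqP[/eqP + /eqP + _]; rewrite !intr_eq0 => /eqP -> /eqP ->.
  by rewrite eqxx.
apply/seteqP; split => y; rewrite /xsection /= inE /circle_set /circle_eq /= => h; lra.
Qed.

Lemma generic_or_circle x y :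
  generic x y \/ exists2 k, k != 0 & circle_set k (x, y).
Proof.
have [|no] := pselect (exists2 k, k != 0 & circle_set k (x, y)); first by right.
left => a b c d e; have [[-> -> -> ->] //|nz] := eqVneq (a, b, c, d) 0.
by case: no; exists (a, b, c, d).
Qed.

(** All pairs with [w] infinite are put in as well: [null_C2] only tests finite [w], so they cost
    nothing, and what remains is described by four real coordinates. *)
Definition nongeneric : set (R[i] * sphere R) := [set p | match p.2 with
  | None => True
  | Some w => ~ (generic (complex.Re p.1) (complex.Im p.1)
                 /\ generic (complex.Re w) (complex.Im w)) end].

Lemma nongeneric_null : null_C2 nongeneric.
Proof.
change ((plane_measure \x plane_measure)%E.-negligible [set p : R4 R |
  nongeneric (p.1.1 +i* p.1.2, Some (p.2.1 +i* p.2.2))%C]).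
(* The integer quadruples are enumerated by [pickle]. A nongeneric finite pair has a component on
   some circle, so it lies in one of countably many null cylinders. *)
pose F (n : nat) : set (R4 R) :=
  match unpickle n : option (int * int * int * int) with
  | Some k => if k == 0 then set0 else circle_set k `*` setT `|` setT `*` circle_set k
  | None => set0 end.
apply: (@negligibleS _ _ _ _ (\bigcup_n F n)).
  move=> -[[x y] [s t]] /= /not_andP[] h.
    have [//|[k k0 kxy]] := generic_or_circle x y.
    exists (pickle k); [exact: I|]; rewrite /F pickleK (negPf k0); left.
    by split; [exact: kxy|exact: I].
  have [//|[k k0 kxy]] := generic_or_circle s t.
  exists (pickle k); [exact: I|]; rewrite /F pickleK (negPf k0); right.
  by split; [exact: I|exact: kxy].
apply: negligible_bigcup => n; rewrite /F.
case: unpickle => [k|]; last exact: negligible_set0.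
have [_|k0] := eqVneq k 0; first exact: negligible_set0.
have mk := measurable_circle_set k.
apply: negligibleU; (apply/negligibleP; first exact: measurableX);
  rewrite [LHS]product_measure1E //.
  by rewrite [X in (X * _)%E]circle_set_null ?mul0e.
by rewrite [X in (_ * X)%E]circle_set_null ?mule0.
Qed.

End Genericity.

(** * Inversion and even translations in real coordinates *)

Section Geometry.
Variable R : realType.
Implicit Types x y s t u v : R.

Lemma generic_neq (a b c d : int) x y : (a, b, c, d) != 0 ->
  generic x y -> circle_eq a b c d x y != 0.
Proof.
by move=> nz g; apply: contra nz => /eqP/g[-> -> -> ->]; rewrite eqxx.
Qed.

Lemma generic_rot x y : generic x y -> generic (- y) x.
Proof.
move=> g a b c d e; have [//|-> -> /eqP + ->] := g a c (- b) d.
  by rewrite -[RHS]e /circle_eq rmorphN /=; ring.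
by rewrite oppr_eq0 => /eqP ->.
Qed.

(** Expanding the equation at the translated point gives an integer equation at the original one,
    with the same [a]. Once [a = 0], the linear coefficients agree too, and then the constants. *)
Lemma generic_translate (m n : int) x y :
  generic x y -> generic (x + m%:~R) (y + n%:~R).
Proof.
move=> g a b c d e.
have [] := g a (2 * a * m + b) (2 * a * n + c)
             (a * (m ^+ 2 + n ^+ 2) + b * m + c * n + d).
  by rewrite -[RHS]e /circle_eq !(rmorphD, rmorphM, rmorphXn) /=; ring.
by move=> -> + + +; rewrite !(mulr0, mul0r, add0r) => -> ->; rewrite !mul0r !add0r.
Qed.

Lemma generic_norm_gt0 x y : generic x y -> 0 < x ^+ 2 + y ^+ 2.
Proof.
move=> /(@generic_neq 1 0 0 0 x y isT); rewrite /circle_eq => h.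
rewrite lt0r addr_ge0 ?sqr_ge0 // andbT; apply: contra h => /eqP ->.
by rewrite mulr0 !mul0r !add0r.
Qed.

(** Multiplied by [|z|^2], the equation at [-1/z] becomes one at [z] with [a] and [d] exchanged and
    the sign of [b] reversed. *)
Lemma generic_inv x y : generic x y ->
  generic (- x / (x ^+ 2 + y ^+ 2)) (y / (x ^+ 2 + y ^+ 2)).
Proof.
move=> g a b c d e; have n0 := generic_norm_gt0 g.
have [] := g d (- b) c a; last by move=> -> /eqP + -> ->; rewrite oppr_eq0 => /eqP ->.
rewrite -[RHS](mulr0 (x ^+ 2 + y ^+ 2)) -e /circle_eq rmorphN /=.
by field; rewrite gt_eqF.
Qed.

Definition sgn (b : bool) : R := if b then 1 else - 1.

Lemma sgnN b : sgn (~~ b) = - sgn b.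
Proof. by case: b; rewrite /= ?opprK. Qed.

(* [sgn b1 * x + sgn b2 * y] is the scalar product of [x + iy] with the corner
   [c = sgn b1 + i sgn b2]; the disk of center [c/2] and radius [1/sqrt 2] is
   [|z|^2 < z.c]. *)
Definition Omega_coord x y s t : Prop := [/\
  forall b1 b2, sgn b1 * x + sgn b2 * y < 1,
  1 < s ^+ 2 + t ^+ 2 &
  forall b1 b2, x ^+ 2 + y ^+ 2 < sgn b1 * x + sgn b2 * y ->
    1 < (s - sgn b1) ^+ 2 + (t - sgn b2) ^+ 2].

Definition inv_Omega_coord x y s t : Prop := [/\
  forall b1 b2, sgn b1 * x + sgn b2 * y < x ^+ 2 + y ^+ 2,
  s ^+ 2 + t ^+ 2 < 1 &
  forall b1 b2, 1 < sgn b1 * x + sgn b2 * y ->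
    1 < (s - sgn b1) ^+ 2 + (t - sgn b2) ^+ 2].

(** Since [-1/z] has coordinates [(-x, y) / |z|^2], its scalar product with a corner [c] is that of
    [z] with the corner [c'] of opposite real part, divided by [|z|^2]; hence the [~~ b1] below.
    Moreover [|-1/w - c|^2 - 1 = (|w - c'|^2 - 1) / |w|^2], because [|c|^2 = 2]. *)
Lemma Omega_coord_inv x y s t : 0 < x ^+ 2 + y ^+ 2 -> 0 < s ^+ 2 + t ^+ 2 ->
  Omega_coord x y s t <->
  inv_Omega_coord (- x / (x ^+ 2 + y ^+ 2)) (y / (x ^+ 2 + y ^+ 2))
                  (- s / (s ^+ 2 + t ^+ 2)) (t / (s ^+ 2 + t ^+ 2)).
Proof.
move=> n0 m0; set n := x ^+ 2 + y ^+ 2 in n0 *; set m := s ^+ 2 + t ^+ 2 in m0 *.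
have nz : n != 0 by rewrite gt_eqF.
have mz : m != 0 by rewrite gt_eqF.
have dotE (c1 c2 : R) : c1 * (- x / n) + c2 * (y / n) = (- c1 * x + c2 * y) / n.
  by field.
have nE : (- x / n) ^+ 2 + (y / n) ^+ 2 = n^-1 by rewrite /n; field.
have mE : (- s / m) ^+ 2 + (t / m) ^+ 2 = m^-1 by rewrite /m; field.
have distE b1 b2 : (1 < (- s / m - sgn b1) ^+ 2 + (t / m - sgn b2) ^+ 2) =
    (1 < (s - sgn (~~ b1)) ^+ 2 + (t - sgn b2) ^+ 2).
  rewrite -subr_gt0 -[RHS]subr_gt0 sgnN -[RHS](pmulr_rgt0 _ (_ : 0 < m^-1)) ?invr_gt0 //.
  congr (0 < _); rewrite /m; case: b1; case: b2 => /=; field => //.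
have in1 b1 b2 : (sgn b1 * (- x / n) + sgn b2 * (y / n) <
    (- x / n) ^+ 2 + (y / n) ^+ 2) = (sgn (~~ b1) * x + sgn b2 * y < 1).
  by rewrite dotE nE sgnN ltr_pdivrMr // mulVf.
have in2 b1 b2 : (1 < sgn b1 * (- x / n) + sgn b2 * (y / n)) =
    (n < sgn (~~ b1) * x + sgn b2 * y).
  by rewrite dotE sgnN ltr_pdivlMr // mul1r.
split=> -[h1 h2 h3]; split.
- by move=> b1 b2; rewrite in1.
- by rewrite mE invf_lt1.
- by move=> b1 b2; rewrite in2 distE; apply: h3.
- by move=> b1 b2; rewrite -(negbK b1) -in1.
- by rewrite -invf_lt1 // -mE.
- by move=> b1 b2; rewrite -(negbK b1) -in2 -distE; apply: h3.
Qed.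

(** Coordinates in the basis [1 + i], [1 - i], the same as in [nearest_even], so that no parity has
    to be tracked. *)
Definition even_point x y : Prop :=
  exists p q : int, x = (p + q)%:~R /\ y = (p - q)%:~R.

Lemma even_pointN x y : even_point x y -> even_point (- x) (- y).
Proof.
move=> [p [q [-> ->]]]; exists (- p), (- q).
by rewrite -!rmorphN /=; split; congr (_%:~R); ring.
Qed.

Lemma even_pointD x y s t :
  even_point x y -> even_point s t -> even_point (x + s) (y + t).
Proof.
move=> [p [q [-> ->]]] [p' [q' [-> ->]]]; exists (p + p'), (q + q').
by rewrite -!rmorphD /=; split; congr (_%:~R); ring.
Qed.

Lemma even_point_sgn b1 b2 : even_point (sgn b1) (sgn b2).
Proof.
case: b1; case: b2; [exists 1, 0|exists 0, 1|exists 0, (- 1)|exists (- 1), 0];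
  by rewrite /= ?addr0 ?subr0 ?add0r ?sub0r ?opprK ?rmorphN.
Qed.

Lemma generic_even_translate x y s t :
  even_point s t -> generic x y -> generic (x + s) (y + t).
Proof. by move=> [p [q [-> ->]]]; apply: generic_translate. Qed.

Lemma int_small (p : int) : -1 < p%:~R :> R -> p%:~R < 1 :> R -> p = 0.
Proof.
move=> h1 h2; have : p < 1 by rewrite -(ltr_int R).
have : -1 < p by rewrite -(ltr_int R) rmorphN1.
lia.
Qed.

(** The squared length is [2 (p^2 + q^2)], so [p^2 + q^2 <= 1]. *)
Lemma even_point_small x y : even_point x y -> x ^+ 2 + y ^+ 2 < 4 ->
  (x = 0 /\ y = 0) \/ exists b1 b2, x = sgn b1 /\ y = sgn b2.
Proof.
move=> [p [q [-> ->]]].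
rewrite -!rmorphXn -rmorphD /= (_ : 4 = 4%:~R) // ltr_int => h.
have hp : p ^+ 2 + q ^+ 2 < 2 by lia.
have : p \in [:: -1; 0; 1] by rewrite !inE; nia.
have : q \in [:: -1; 0; 1] by rewrite !inE; nia.
rewrite !inE => /or3P[] /eqP qE /or3P[] /eqP pE; subst p q => //.
- by right; exists false, true.
- by right; exists false, false.
- by left.
- by right; exists true, true.
- by right; exists true, false.
Qed.

(** Parallelogram law. Combined with [even_point_small], it leaves only 0 and the corners as
    possible even differences. *)
Lemma unit_disks_near x y s t : x ^+ 2 + y ^+ 2 < 1 -> s ^+ 2 + t ^+ 2 <= 1 ->
  (x - s) ^+ 2 + (y - t) ^+ 2 < 4.
Proof.
move=> h1 h2; have := sqr_ge0 (x + s); have := sqr_ge0 (y + t); lra.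
Qed.

(** Up to signs, this says that the four disks of center [c/2] cover [Kset]. *)
Lemma sum_sqr_le x y : 0 <= x -> 0 <= y -> x + y <= 1 ->
  x ^+ 2 + y ^+ 2 <= x + y.
Proof. by move=> x0 y0 xy; nra. Qed.

Lemma even_point_translate_Omega_coord x y s t (a b : R) :
  even_point a b -> inv_Omega_coord x y s t ->
  (forall b1 b2, sgn b1 * (x - a) + sgn b2 * (y - b) < 1) ->
  Omega_coord (x - a) (y - b) (s - a) (t - b).
Proof.
move=> ev [h1 h2 h3] hK.
(* With [a = b = 0] the point would lie inside [Kset] but outside all four disks that cover it. *)
have a0 : ~ (a = 0 /\ b = 0).
  move=> [a0 b0]; subst a b.
  have tri (p q : R) : 0 <= p -> 0 <= q -> p + q < 1 -> ~ p + q < p ^+ 2 + q ^+ 2.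
    by move=> p0 q0 /ltW pq; rewrite ltNge sum_sqr_le.
  have [x0|x0] := leP 0 x; have [y0|y0] := leP 0 y.
  - by have := h1 true true; have := hK true true; rewrite /= !subr0 => ? ?;
      apply: (tri x y); lra.
  - by have := h1 true false; have := hK true false; rewrite /= !subr0 => ? ?;
      apply: (tri x (- y)); lra.
  - by have := h1 false true; have := hK false true; rewrite /= !subr0 => ? ?;
      apply: (tri (- x) y); lra.
  - by have := h1 false false; have := hK false false; rewrite /= !subr0 => ? ?;
      apply: (tri (- x) (- y)); lra.
(* Translation by [c] carries the disk of center [-c/2] to the one of center [c/2], and the point
   avoids the former by [h1]. *)
have neg c1 c2 : x - a = x + sgn c1 -> y - b = y + sgn c2 ->
   ~ ((x - a) ^+ 2 + (y - b) ^+ 2 < sgn c1 * (x - a) + sgn c2 * (y - b)).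
  move=> -> -> h; have := h1 (~~ c1) (~~ c2).
  by move: h; rewrite !sgnN; case: c1; case: c2 => /=; lra.
split=> //.
  (* If the translate of [v] has length at most 1, the translation vector is a corner [c]. Then
     [(u - c).(-c) < 1] gives [u.c > 1], so [h3] yields [|v - c| > 1]. *)
  rewrite ltNge; apply/negP => hle.
  have := unit_disks_near h2 hle.
  rewrite !subKr => /(even_point_small ev)[//|[b1 [b2 [aE bE]]]].
  suff /h3 : 1 < sgn b1 * x + sgn b2 * y by rewrite -aE -bE ltNge hle.
  have := hK (~~ b1) (~~ b2); rewrite !sgnN aE bE.
  by case: b1 {aE bE}; case: b2 => /=; lra.
(* Here the translation vector plus [c] is even and shorter than 2. It is not 0 by [neg], so it is a
   corner [b], and [h3] is contradicted at [b]. *)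
move=> c1 c2 hd; rewrite ltNge; apply/negP => hle.
have evc := even_pointD ev (even_point_sgn c1 c2).
have := unit_disks_near h2 hle.
rewrite (_ : s - _ = a + sgn c1); last by ring.
rewrite (_ : t - _ = b + sgn c2); last by ring.
move=> /(even_point_small evc)[[e1 e2]|[b1 [b2 [e1 e2]]]].
  by apply: neg hd; lra.
have aE : a = sgn b1 - sgn c1 by lra.
have bE : b = sgn b2 - sgn c2 by lra.
move: hle; rewrite (_ : s - a - _ = s - sgn b1); last by rewrite aE; ring.
rewrite (_ : t - b - _ = t - sgn b2); last by rewrite bE; ring.
apply/negP; rewrite -ltNge; apply: h3.
have := hK (~~ b1) (~~ b2); rewrite !sgnN aE bE.
(* Distinct corners satisfy [b.c <= 0], whence [u.b > (b - c).b - 1 >= 1], as [h3] requires. *)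
have bc : ~ (b1 = c1 /\ b2 = c2).
  by move=> [b1E b2E]; apply: a0; rewrite aE bE b1E b2E !subrr.
case: b1 bc {aE bE e1 e2}; case: b2; case: c1 {hd evc}; case: c2 => bc /=;
  first [by case: bc | lra].
Qed.

Lemma generic_line b1 b2 x y : generic x y -> sgn b1 * x + sgn b2 * y != 1.
Proof.
move=> /(@generic_neq 0 (if b1 then 1 else - 1) (if b2 then 1 else - 1) (- 1)) h.
apply: contra (h _) => [/eqP e|]; last by case: (b1); case: (b2).
apply/eqP; move: e; rewrite /circle_eq; clear.
by case: b1; case: b2 => /= e; rewrite ?rmorphN1 ?mulr1z ?mulr0z; lra.
Qed.

Lemma generic_disk b1 b2 x y : generic x y ->
  sgn b1 * x + sgn b2 * y != x ^+ 2 + y ^+ 2.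
Proof.
move=> /(@generic_neq 1 (if b1 then - 1 else 1) (if b2 then - 1 else 1) 0) h.
apply: contra (h _) => [/eqP e|]; last by case: (b1); case: (b2).
apply/eqP; move: e; rewrite /circle_eq; clear.
by case: b1; case: b2 => /= e; rewrite ?rmorphN1 ?mulr1z ?mulr0z; lra.
Qed.

Lemma generic_unit_circle x y : generic x y -> x ^+ 2 + y ^+ 2 != 1.
Proof.
move=> /(@generic_neq 1 0 0 (- 1) _ _ isT); apply: contra => /eqP e.
by rewrite /circle_eq e rmorphN1; apply/eqP; ring.
Qed.

Lemma inv_Omega_coord_translate_inj x y s t x' y' s' t' : generic x y ->
  inv_Omega_coord x y s t -> inv_Omega_coord x' y' s' t' -> even_point (x - x') (y - y') ->
  s - s' = x - x' -> t - t' = y - y' -> x = x' /\ y = y'.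
Proof.
move=> g [_ h2 h3] [_ h2' h3'] ev e1 e2.
have := unit_disks_near h2 (ltW h2'); rewrite e1 e2 => /(even_point_small ev).
move=> [[d1 d2]|[b1 [b2 [d1 d2]]]]; first by split; lra.
exfalso.
have sE : s - sgn b1 = s' by lra.
have tE : t - sgn b2 = t' by lra.
have sE' : s' - sgn (~~ b1) = s by rewrite sgnN; lra.
have tE' : t' - sgn (~~ b2) = t by rewrite sgnN; lra.
(* With [v' = v - c] and [v = v' + c] both in the unit disk, [h3] at [c] and [h3'] at [-c] must have
   false premises: [u.c <= 1] and [(u - c).(-c) <= 1], that is, [u.c >= 1]. *)
have k : sgn b1 * x + sgn b2 * y <= 1.
  by rewrite leNgt; apply/negP => /h3; rewrite sE tE ltNge (ltW h2').
have k' : sgn (~~ b1) * x' + sgn (~~ b2) * y' <= 1.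
  by rewrite leNgt; apply/negP => /h3'; rewrite sE' tE' ltNge (ltW h2).
have /eqP[] := generic_line b1 b2 g.
have xE : x' = x - sgn b1 by lra.
have yE : y' = y - sgn b2 by lra.
move: k k'; rewrite !sgnN xE yE; clear.
by case: b1; case: b2 => /=; lra.
Qed.

(** The floors bound [|s + t - 2p|] and [|s - t - 2q|] by 1, and half the sum of their squares is
    the squared distance. Genericity excludes the value 1. *)
Lemma nearest_even_point s t : generic s t ->
  exists a b : R, even_point a b /\ (s + a) ^+ 2 + (t + b) ^+ 2 < 1.
Proof.
move=> g; pose p := Num.floor ((s + t + 1) / 2); pose q := Num.floor ((s - t + 1) / 2).
have ev : even_point (- (p + q)%:~R) (- (p - q)%:~R : R).
  by apply: even_pointN; exists p, q.
exists (- (p + q)%:~R), (- (p - q)%:~R); split=> //.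
have := generic_even_translate ev g.
move/generic_unit_circle => h; rewrite lt_neqAle h /=.
have /andP[] := floor_itv ((s + t + 1) / 2).
have /andP[] := floor_itv ((s - t + 1) / 2).
rewrite -/p -/q !rmorphD rmorphN /= => ? ? ? ?.
have : (s + t - 2 * p%:~R) ^+ 2 <= 1 by nra.
have : (s - t - 2 * q%:~R) ^+ 2 <= 1 by nra.
lra.
Qed.

(** The even lattice is stable under sign changes, so any corner can be reflected to [1 + i]. *)
Lemma even_point_sgn_coord b1 b2 x y : even_point x y ->
  exists p q : int, x = sgn b1 * (p + q)%:~R /\ y = sgn b2 * (p - q)%:~R.
Proof.
move=> [p [q [-> ->]]]; case: b1; case: b2 => /=;
  [exists p, q | exists q, p | exists (- q), (- p) | exists (- p), (- q)];
  rewrite ?mul1r ?mulN1r -?rmorphN /=; split; congr (_%:~R); ring.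
Qed.

Lemma Omega_coord_translate_outside x y s t (a b : R) :
  generic (x + a) (y + b) -> Omega_coord x y s t ->
  even_point a b -> (s + a) ^+ 2 + (t + b) ^+ 2 < 1 -> forall b1 b2,
  sgn b1 * (x + a) + sgn b2 * (y + b) < (x + a) ^+ 2 + (y + b) ^+ 2.
Proof.
move=> g [h1 h2 h3] ev h4 b1 b2.
rewrite lt_neqAle generic_disk //=.
rewrite leNgt; apply/negP => lt.
have [[a0 b0]|[a1 b1E]] : (a = 0 /\ b = 0) \/ (a = sgn b1 /\ b = sgn b2).
  have [p [q [aE bE]]] := even_point_sgn_coord b1 b2 ev.
  have sq c : sgn c ^+ 2 = 1 by case: c; rewrite /= ?sqrrN expr1n.
  pose X := sgn b1 * x; pose Y := sgn b2 * y.
  have XE : sgn b1 * (x + a) = X + p%:~R + q%:~R.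
    by rewrite aE mulrDr mulrA -expr2 sq mul1r rmorphD /= addrA.
  have YE : sgn b2 * (y + b) = Y + p%:~R - q%:~R.
    by rewrite bE mulrDr mulrA -expr2 sq mul1r rmorphB /= addrA.
  have := lt; rewrite -[(x + a) ^+ 2]mul1r -[(y + b) ^+ 2]mul1r.
  rewrite -{1}(sq b1) -(sq b2) -!exprMn XE YE => {}lt.
  (* The disk condition reads [(X + Y + 2p - 1)^2 + (X - Y + 2q)^2 < 1], while [X + Y] and [X - Y]
     lie in the open interval from -1 to 1. This forces [q = 0] and [p = 0] or [p = 1], so the
     translation is by 0 or by the corner itself. *)
  have k1 := h1 b1 b2; have k2 := h1 (~~ b1) (~~ b2).
  have k3 := h1 b1 (~~ b2); have k4 := h1 (~~ b1) b2.
  rewrite !sgnN !mulNr -/X -/Y in k1 k2 k3 k4.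
  have B : (X - Y + 2 * q%:~R) ^+ 2 < 1 by have := sqr_ge0 (X + Y + 2 * p%:~R - 1); lra.
  have A : (X + Y + 2 * p%:~R - 1) ^+ 2 < 1 by have := sqr_ge0 (X - Y + 2 * q%:~R); lra.
  have q0 : q = 0 by apply: int_small; nra.
  have p1 : p < 2 by rewrite -(ltr_int R) (_ : 2%:~R = 2 :> R) //; nra.
  have p2 : - 1 < p by rewrite -(ltr_int R) rmorphN1; nra.
  have : p = 0 \/ p = 1 by lia.
  by rewrite aE bE q0 => -[] ->; [left|right]; rewrite ?addr0 ?subr0 ?mulr0 ?mulr1.
  by move: h4; rewrite a0 b0 !addr0; lra.
(* Since [z + c] is in the disk of center [c/2], [z] is in that of center [-c/2]; then [|w + c| > 1]
   contradicts [h4]. *)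
have := h3 (~~ b1) (~~ b2); rewrite !sgnN a1 b1E in lt h4 *.
rewrite !opprK => /(_ _)/wrap[]; last by lra.
by move: lt; clear; case: b1; case: b2 => /=; lra.
Qed.

Lemma Omega_coord_translate_surj x y s t : generic x y -> generic s t -> Omega_coord x y s t ->
  exists a b : R, even_point a b /\ inv_Omega_coord (x + a) (y + b) (s + a) (t + b).
Proof.
move=> gz gw O.
have [a [b [ev h]]] := nearest_even_point gw.
have out := Omega_coord_translate_outside (generic_even_translate ev gz) O ev h.
have [B|] := pselect (forall b1 b2, 1 < sgn b1 * (x + a) + sgn b2 * (y + b) ->
    1 < (s + a - sgn b1) ^+ 2 + (t + b - sgn b2) ^+ 2); first by exists a, b.
move=> /existsNP[c1 /existsNP[c2 /not_implyP[k /negP]]]; rewrite -leNgt => hle.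
have evc : even_point (a - sgn c1) (b - sgn c2).
  exact: even_pointD ev (even_pointN (even_point_sgn c1 c2)).
have hlt : (s + (a - sgn c1)) ^+ 2 + (t + (b - sgn c2)) ^+ 2 < 1.
  rewrite lt_neqAle generic_unit_circle ?addrA //.
  by rewrite -!addrA; apply: generic_even_translate.
exists (a - sgn c1), (b - sgn c2); split=> //; split=> //.
  exact: Omega_coord_translate_outside (generic_even_translate evc gz) O evc hlt.
(* A failure at a second corner [c'] would make [c + c'] shorter than 2, so [c' = -c]. But [u.c > 1]
   and [(u - c).(-c) > 1] are incompatible. *)
move=> b1 b2 k2; rewrite ltNge; apply/negP => hle2.
have := unit_disks_near h hle2.
rewrite (_ : _ - _ = sgn c1 + sgn b1); last by ring.
rewrite (_ : t + b - _ = sgn c2 + sgn b2); last by ring.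
move: k k2; rewrite !addrA; clear.
by case: c1; case: c2; case: b1; case: b2 => /=; lra.
Qed.

End Geometry.

(** * Complex numbers, the sphere and the eight pieces *)

Section Sphere.
Variable R : realType.
Implicit Types x y s t : R.
Local Open Scope complex_scope.

Lemma half_complex x y : (x +i* y) / 2 = (x / 2) +i* (y / 2).
Proof.
apply: (@mulIf _ (2 : R[i])); first by rewrite pnatr_eq0.
rewrite divfK ?pnatr_eq0 // mulr_natr mulr2n.
by apply/eqP; rewrite eq_complex /=; apply/andP; split; apply/eqP; lra.
Qed.

Lemma opp_inv_complex x y : - 1 / (x +i* y) =
  (- x / (x ^+ 2 + y ^+ 2)) +i* (y / (x ^+ 2 + y ^+ 2)).
Proof.
by apply/eqP; rewrite mulN1r eq_complex /= opprK mulNr !eqxx.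
Qed.

Lemma normc_lt1 x y : (`|x +i* y| < 1) = (x ^+ 2 + y ^+ 2 < 1).
Proof. by rewrite normc_def (ltcR _ 1) /= -{1}[1]sqrtr1 ltr_sqrt. Qed.

Lemma normc_le_inv_sqrt2 x y :
  (`|x +i* y| <= inv_sqrt2 R) = (x ^+ 2 + y ^+ 2 <= 2^-1).
Proof.
by rewrite normc_def lecR /= -sqrtrV // ler_psqrt // nnegrE ?addr_ge0 ?sqr_ge0.
Qed.

Lemma normc_ge_inv_sqrt2 x y :
  (inv_sqrt2 R <= `|x +i* y|) = (2^-1 <= x ^+ 2 + y ^+ 2).
Proof.
by rewrite normc_def lecR /= -sqrtrV // ler_psqrt // nnegrE ?addr_ge0 ?sqr_ge0.
Qed.

Lemma Kset_sgn x y :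
  Kset (x +i* y) <-> forall b1 b2, sgn R b1 * x + sgn R b2 * y <= 1.
Proof.
rewrite /Kset /=; split => [h b1 b2|h].
  have := ler_norm x; have := ler_norm (- x); have := ler_norm y.
  by have := ler_norm (- y); rewrite !normrN; case: b1; case: b2 => /=; lra.
have := h true true; have := h true false; have := h false true.
have := h false false => /=.
by have [x0|x0] := ler0P x; have [y0|y0] := ler0P y; lra.
Qed.

(** At concrete booleans the left side is the spelling of the corners in [K1], [K2], [L1] and
    [L2]. *)
Lemma sgn_point b1 b2 :
  (if b1 then 1 else - 1) + (if b2 then 'i else - 'i) = sgn R b1 +i* sgn R b2.
Proof.
by apply/eqP; rewrite eq_complex; case: b1; case: b2;
  rewrite /= ?oppr0 ?addr0 ?add0r !eqxx.
Qed.

Lemma half_disk_le b1 b2 x y :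
  (`|(x +i* y) - (sgn R b1 +i* sgn R b2) / 2| <= inv_sqrt2 R) =
  (x ^+ 2 + y ^+ 2 <= sgn R b1 * x + sgn R b2 * y).
Proof.
rewrite half_complex normc_le_inv_sqrt2.
by case: b1; case: b2 => /=; apply/idP/idP; lra.
Qed.

Lemma half_disk_ge b1 b2 x y :
  (inv_sqrt2 R <= `|(x +i* y) - (sgn R b1 +i* sgn R b2) / 2|) =
  (sgn R b1 * x + sgn R b2 * y <= x ^+ 2 + y ^+ 2).
Proof.
rewrite half_complex normc_ge_inv_sqrt2.
by case: b1; case: b2 => /=; apply/idP/idP; lra.
Qed.

Lemma unit_disk_lt b1 b2 s t :
  (`|(s +i* t) - (sgn R b1 +i* sgn R b2)| < 1) =
  ((s - sgn R b1) ^+ 2 + (t - sgn R b2) ^+ 2 < 1).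
Proof. exact: normc_lt1. Qed.

Lemma K1_sgn x y : K1 (x +i* y) <-> [/\ Kset (x +i* y),
  x ^+ 2 + y ^+ 2 <= sgn R false * x + sgn R true * y &
  x ^+ 2 + y ^+ 2 <= sgn R false * x + sgn R false * y].
Proof.
rewrite /K1 /=.
by rewrite (sgn_point false true) (sgn_point false false) !half_disk_le.
Qed.

Lemma K2_sgn x y : K2 (x +i* y) <-> [/\ Kset (x +i* y),
  x ^+ 2 + y ^+ 2 <= sgn R false * x + sgn R true * y,
  sgn R false * x + sgn R false * y <= x ^+ 2 + y ^+ 2 &
  sgn R true * x + sgn R true * y <= x ^+ 2 + y ^+ 2].
Proof.
rewrite /K2 /=.
by rewrite (sgn_point false true) (sgn_point false false) (sgn_point true true)
  half_disk_le !half_disk_ge.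
Qed.

Lemma L2_sgn s t : L2 (Some (s +i* t)) <-> 1 <= s ^+ 2 + t ^+ 2 /\
  1 <= (s - sgn R false) ^+ 2 + (t - sgn R true) ^+ 2.
Proof.
rewrite /L2 /B (sgn_point false true); split.
  move=> h; rewrite !leNgt -normc_lt1 -unit_disk_lt; split; apply/negP => hB;
    apply: h; exists (s +i* t) => //; [left|right] => //.
  by rewrite /= subr0.
move=> [h1 h2] [w hw [wE]]; subst w; case: hw; rewrite /mkset.
  by rewrite subr0 normc_lt1 ltNge h1.
by rewrite unit_disk_lt ltNge h2.
Qed.

Lemma L1_sgn s t : L1 (Some (s +i* t)) <-> [/\ 1 <= s ^+ 2 + t ^+ 2,
  1 <= (s - sgn R false) ^+ 2 + (t - sgn R true) ^+ 2 &
  1 <= (s - sgn R false) ^+ 2 + (t - sgn R false) ^+ 2].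
Proof.
rewrite /L1 /B (sgn_point false true) (sgn_point false false); split.
  move=> h; rewrite !leNgt -normc_lt1 -!unit_disk_lt; split; apply/negP => hB;
    apply: h; exists (s +i* t) => //; [left; left|left; right|right] => //.
  by rewrite /= subr0.
move=> [h1 h2 h3] [w hw [wE]]; subst w; case: hw => [[]|]; rewrite /mkset.
- by rewrite subr0 normc_lt1 ltNge h1.
- by rewrite unit_disk_lt ltNge h2.
- by rewrite unit_disk_lt ltNge h3.
Qed.

Lemma mul_negiE x y : mul_negi (- y +i* x) = x +i* y.
Proof.
by rewrite /mul_negi; apply/eqP; rewrite eq_complex /=; apply/andP; split;
  apply/eqP; ring.
Qed.

Lemma mul_negi_inj : injective (@mul_negi R).
Proof.
by apply: mulfI; rewrite oppr_eq0 eq_complex /= oner_eq0 andbF.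
Qed.

(** The recursion of [K_] starts at index 3; membership is pulled back along multiplication by
    [i]. *)
Lemma K_rot j x y : K_ j.+3 (x +i* y) <-> K_ j.+1 (- y +i* x).
Proof.
split=> [[z Kz]|Kz]; last by exists (- y +i* x) => //; apply: mul_negiE.
by rewrite -mul_negiE => /mul_negi_inj zE; rewrite -zE.
Qed.

Lemma L_rot j s t : L_ j.+3 (Some (s +i* t)) <-> L_ j.+1 (Some (- t +i* s)).
Proof.
split=> [[[w|] Lw] //|Lw].
  by rewrite -mul_negiE => -[/mul_negi_inj wE]; rewrite -wE.
by exists (Some (- t +i* s)) => //=; rewrite mul_negiE.
Qed.

Lemma Omega_coord_rot x y s t : Omega_coord (- y) x (- t) s -> Omega_coord x y s t.
Proof.
move=> [h1 h2 h3]; split; first by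
  move=> b1 b2; have := h1 (~~ b2) b1; rewrite sgnN; lra.
  by move: h2; lra.
move=> b1 b2 h; have := h3 (~~ b2) b1; rewrite sgnN => /(_ _)/wrap[]; lra.
Qed.

Lemma generic_Omega_coord_of_pieces x y s t j : generic x y -> generic s t ->
  K_ j.+1 (x +i* y) -> L_ j.+1 (Some (s +i* t)) -> Omega_coord x y s t.
Proof.
have K12 k (u v p q : R) : (k < 2)%N -> generic u v -> generic p q ->
    K_ k.+1 (u +i* v) -> L_ k.+1 (Some (p +i* q)) -> Omega_coord u v p q.
  move=> k2 gz gw Kz Lw.
  have out b1 b2 : 1 <= (p - sgn R b1) ^+ 2 + (q - sgn R b2) ^+ 2 ->
      1 < (p - sgn R b1) ^+ 2 + (q - sgn R b2) ^+ 2.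
    move=> h; rewrite lt_neqAle h andbT eq_sym.
    apply: generic_unit_circle; apply: generic_even_translate => //.
    exact: even_pointN (even_point_sgn _ _ _).
  have [Kuv Lpq hd] : [/\ Kset (u +i* v), 1 <= p ^+ 2 + q ^+ 2 &
      (* The half disks at opposite corners have disjoint interiors. So only the two left corners
         are possible on [K1] and only [-1 + i] on [K2], exactly those whose unit disks are removed
         in [L1] and [L2]. *)
      forall b1 b2, u ^+ 2 + v ^+ 2 < sgn R b1 * u + sgn R b2 * v ->
        1 < (p - sgn R b1) ^+ 2 + (q - sgn R b2) ^+ 2].
    have uv0 : 0 <= u ^+ 2 + v ^+ 2 by rewrite addr_ge0 ?sqr_ge0.
    case: k k2 Kz Lw => [|[|//]] _.
      move=> /K1_sgn[? d1 d2] /L1_sgn[? o1 o2]; split=> // -[] [] h.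
      - by move: uv0 h d1 d2 => /=; lra.
      - by move: uv0 h d1 d2 => /=; lra.
      - exact: out.
      - exact: out.
    move=> /K2_sgn[? d1 d2 d3] /L2_sgn[? o1]; split=> // -[] [] h.
    - by move: h d3; lra.
    - by move: uv0 h d1 => /=; lra.
    - exact: out.
    - by move: h d2; lra.
  split=> // [b1 b2|].
    by rewrite lt_neqAle generic_line //=; apply: (proj1 (Kset_sgn u v)).
  by rewrite lt_neqAle eq_sym generic_unit_circle.
elim/ltn_ind: j x y s t => -[|[|j]] IH x y s t gz gw; [exact: K12|exact: K12|].
rewrite K_rot L_rot => Kz Lw; apply: Omega_coord_rot.
by apply: (IH j) => //; apply: generic_rot.
Qed.

Lemma generic_rot_Omega_coord x y s t : generic x y /\ Omega_coord x y s t ->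
  generic (- y) x /\ Omega_coord (- y) x (- t) s.
Proof.
move=> [g h]; split; first exact: generic_rot.
(* Three further quarter turns bring the rotated pair back to the original one. *)
by do 3 apply: Omega_coord_rot; rewrite !opprK.
Qed.

Lemma Omega_coord_Kset x y s t : Omega_coord x y s t -> Kset (x +i* y).
Proof. by move=> [h _ _]; apply/Kset_sgn => b1 b2; apply: ltW. Qed.

Lemma Omega_coord_disk x y s t b1 b2 : generic x y /\ Omega_coord x y s t ->
  x ^+ 2 + y ^+ 2 <= sgn R b1 * x + sgn R b2 * y ->
  1 <= (s - sgn R b1) ^+ 2 + (t - sgn R b2) ^+ 2.
Proof.
move=> [g [_ _ h]] d; apply: ltW; apply: h.
by rewrite lt_neqAle d andbT eq_sym generic_disk.
Qed.

Lemma Omega_coord_piece1 x y s t : generic x y /\ Omega_coord x y s t ->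
  x ^+ 2 + y ^+ 2 <= - x + y -> x ^+ 2 + y ^+ 2 <= - x - y ->
  K1 (x +i* y) /\ L1 (Some (s +i* t)).
Proof.
move=> gO d1 d2.
have e1 : x ^+ 2 + y ^+ 2 <= sgn R false * x + sgn R true * y by rewrite /=; lra.
have e2 : x ^+ 2 + y ^+ 2 <= sgn R false * x + sgn R false * y by rewrite /=; lra.
split; first by apply/K1_sgn; split=> //; exact: Omega_coord_Kset gO.2.
apply/L1_sgn; split; [|exact: Omega_coord_disk e1|exact: Omega_coord_disk e2].
by case: gO => _ [_ /ltW].
Qed.

Lemma Omega_coord_piece2 x y s t : generic x y /\ Omega_coord x y s t ->
  x ^+ 2 + y ^+ 2 <= - x + y -> - x - y < x ^+ 2 + y ^+ 2 ->
  x + y < x ^+ 2 + y ^+ 2 -> K2 (x +i* y) /\ L2 (Some (s +i* t)).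
Proof.
move=> gO d1 d2 d3.
have e1 : x ^+ 2 + y ^+ 2 <= sgn R false * x + sgn R true * y by rewrite /=; lra.
split; first by apply/K2_sgn; split=> //; [exact: Omega_coord_Kset gO.2| |] => /=; lra.
apply/L2_sgn; split; [|exact: Omega_coord_disk e1].
by case: gO => _ [_ /ltW].
Qed.

(** The index is read off from the half disks containing [z]: two at adjacent corners for odd [j], a
    single one for even [j], in cyclic order. *)
Lemma Omega_of_coord x y s t : generic x y -> Omega_coord x y s t ->
  Omega (x +i* y, Some (s +i* t)).
Proof.
move=> g O; have gO := conj g O.
have gO1 := generic_rot_Omega_coord gO; have gO2 := generic_rot_Omega_coord gO1.
have gO3 := generic_rot_Omega_coord gO2.
suff [j [j1 j8 [Kz Lw]]] : exists j, [/\ (1 <= j)%N, (j <= 8)%N &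
    K_ j (x +i* y) /\ L_ j (Some (s +i* t))].
  by exists j => /=; [apply/andP|].
have [mp|mp] := leP (x ^+ 2 + y ^+ 2) (- x + y).
  have [mm|mm] := leP (x ^+ 2 + y ^+ 2) (- x - y).
    by exists 1%N; split=> //; apply: Omega_coord_piece1.
  have [pp|pp] := leP (x ^+ 2 + y ^+ 2) (x + y).
    by exists 3%N; split=> //; rewrite K_rot L_rot;
      apply: Omega_coord_piece1 => //; lra.
  by exists 2%N; split=> //; apply: Omega_coord_piece2.
have [pp|pp] := leP (x ^+ 2 + y ^+ 2) (x + y).
  have [pm|pm] := leP (x ^+ 2 + y ^+ 2) (x - y).
    by exists 5%N; split=> //; rewrite !K_rot !L_rot;
      apply: Omega_coord_piece1 => //; lra.
  by exists 4%N; split=> //; rewrite !K_rot !L_rot;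
    apply: Omega_coord_piece2 => //; lra.
have [pm|pm] := leP (x ^+ 2 + y ^+ 2) (x - y).
  have [mm|mm] := leP (x ^+ 2 + y ^+ 2) (- x - y).
    by exists 7%N; split=> //; rewrite !K_rot !L_rot;
      apply: Omega_coord_piece1 => //; lra.
  by exists 6%N; split=> //; rewrite !K_rot !L_rot;
    apply: Omega_coord_piece2 => //; lra.
(* Three disks are excluded, so [z] is in the fourth because the disks cover [Kset]. *)
exists 8%N; split=> //; rewrite !K_rot !L_rot; apply: Omega_coord_piece2 => //; try lra.
have := sum_sqr_le (normr_ge0 x) (normr_ge0 y) (Omega_coord_Kset O).
rewrite !real_normK ?num_real //.
by have [x0|x0] := ler0P x; have [y0|y0] := ler0P y; lra.
Qed.

Lemma OmegaP x y s t : generic x y -> generic s t ->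
  Omega (x +i* y, Some (s +i* t)) <-> Omega_coord x y s t.
Proof.
move=> gz gw; split; last exact: Omega_of_coord.
by move=> [[|j] //= _ [Kz Lw]]; apply: (@generic_Omega_coord_of_pieces _ _ _ _ j).
Qed.

(** * The map [Ghat] on generic points *)

Lemma nearest_even_complex x y : exists a b : R,
  [/\ even_point a b, nearest_even (x +i* y) = a +i* b &
      forall b1 b2, sgn R b1 * (x - a) + sgn R b2 * (y - b) <= 1].
Proof.
pose p := Num.floor ((x + y + 1) / 2); pose q := Num.floor ((x - y + 1) / 2).
exists (p + q)%:~R, (p - q)%:~R; split; first by exists p, q.
  rewrite /nearest_even -/p -/q.
  rewrite -!(rmorph_int (real_complex R)) /=; apply/eqP.
  by rewrite eq_complex /= !rmorphD rmorphN /=; apply/andP; split; apply/eqP; ring.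
have /andP[] := floor_itv ((x + y + 1) / 2).
have /andP[] := floor_itv ((x - y + 1) / 2).
rewrite -/p -/q !rmorphD rmorphN /= => ? ? ? ?.
by move=> [] [] /=; lra.
Qed.

(** The strict inequalities put [x + y - 2p] and [x - y - 2q] between -1 and 1, which pins both
    floors. *)
Lemma nearest_even_eq x y a b : even_point a b ->
  (forall b1 b2, sgn R b1 * (x - a) + sgn R b2 * (y - b) < 1) ->
  nearest_even (x +i* y) = a +i* b.
Proof.
move=> [p [q [-> ->]]] h.
have := h true true; have := h false false; have := h true false.
have := h false true; rewrite /= !rmorphD rmorphN /= => h1 h2 h3 h4.
have pE : Num.floor ((x + y + 1) / 2) = p.
  by apply: floor_def; rewrite rmorphD /=; apply/andP; split; lra.
have qE : Num.floor ((x - y + 1) / 2) = q.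
  by apply: floor_def; rewrite rmorphD /=; apply/andP; split; lra.
rewrite /nearest_even /= pE qE -!(rmorph_int (real_complex R)) /=; apply/eqP.
by rewrite eq_complex /=; apply/andP; split; apply/eqP; ring.
Qed.

Lemma Ghat_complex x y s t (a b : R) : generic s t ->
  nearest_even (- x / (x ^+ 2 + y ^+ 2) +i* (y / (x ^+ 2 + y ^+ 2))) = a +i* b ->
  Ghat (x +i* y, Some (s +i* t)) =
  ((- x / (x ^+ 2 + y ^+ 2) - a) +i* (y / (x ^+ 2 + y ^+ 2) - b),
   Some ((- s / (s ^+ 2 + t ^+ 2) - a) +i* (t / (s ^+ 2 + t ^+ 2) - b))).
Proof.
move=> /generic_norm_gt0 m0 aE.
have nz : (s +i* t == 0) = false.
  by apply/eqP => -[s0 t0]; move: m0; rewrite s0 t0 expr0n /= addr0 ltxx.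
have inE : sphere_neg_inv (Some (s +i* t)) = Some (- 1 / (s +i* t)).
  by rewrite /sphere_neg_inv nz.
by rewrite /Ghat [sphere_neg_inv _]inE !opp_inv_complex aE.
Qed.

Lemma inv_inv_coord x y : 0 < x ^+ 2 + y ^+ 2 ->
  let n := x ^+ 2 + y ^+ 2 in let m := (- x / n) ^+ 2 + (y / n) ^+ 2 in
  - (- x / n) / m = x /\ y / n / m = y.
Proof.
move=> n0 n m; have nz : n != 0 by rewrite gt_eqF.
have -> : m = n^-1 by rewrite /m /n; field.
by rewrite invrK; split; field.
Qed.

Lemma OmegaD_generic p : (Omega (R := R) `\` @nongeneric R) p ->
  exists x y s t, [/\ p = (x +i* y, Some (s +i* t)), generic x y, generic s t
    & Omega_coord x y s t].
Proof.
case: p => -[x y] [[s t]| ] [hO ng]; last by case: (ng I).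
move: ng => /contrapT[gz gw]; exists x, y, s, t; split=> //.
exact/OmegaP.
Qed.

Lemma generic_OmegaD x y s t : generic x y -> generic s t -> Omega_coord x y s t ->
  (Omega (R := R) `\` @nongeneric R) (x +i* y, Some (s +i* t)).
Proof.
by move=> gz gw O; split; [exact/OmegaP|move=> /=; apply].
Qed.

Lemma Ghat_generic x y s t : generic x y -> generic s t -> Omega_coord x y s t ->
  exists a b : R, even_point a b /\
    let u := - x / (x ^+ 2 + y ^+ 2) in let u' := y / (x ^+ 2 + y ^+ 2) in
    let v := - s / (s ^+ 2 + t ^+ 2) in let v' := t / (s ^+ 2 + t ^+ 2) in
    [/\ Ghat (x +i* y, Some (s +i* t)) =
          ((u - a) +i* (u' - b), Some ((v - a) +i* (v' - b))),
        inv_Omega_coord u u' v v',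
        generic (u - a) (u' - b) /\ generic (v - a) (v' - b) &
        Omega_coord (u - a) (u' - b) (v - a) (v' - b)].
Proof.
move=> gz gw O.
have [a [b [ev aE hle]]] := nearest_even_complex (- x / (x ^+ 2 + y ^+ 2))
  (y / (x ^+ 2 + y ^+ 2)).
exists a, b; split=> // u u' v v'.
have OI : inv_Omega_coord u u' v v' by apply/Omega_coord_inv => //; exact: generic_norm_gt0.
have evN := even_pointN ev.
have gu : generic (u - a) (u' - b).
  by apply: generic_even_translate => //; exact: generic_inv.
split=> //.
- exact: Ghat_complex.
- by split=> //; apply: generic_even_translate => //; exact: generic_inv.
- apply: even_point_translate_Omega_coord => // b1 b2.
  by rewrite lt_neqAle generic_line //=.
Qed.

Lemma Ghat_inj : set_inj (Omega (R := R) `\` @nongeneric R) (@Ghat R).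
Proof.
move=> p1 p2; rewrite !inE => /OmegaD_generic[x [y [s [t [-> gz gw O]]]]].
move=> /OmegaD_generic[x' [y' [s' [t' [-> gz' gw' O']]]]].
have [a [b [ev /= [-> OI _ _]]]] := Ghat_generic gz gw O.
have [a' [b' [ev' /= [-> OI' _ _]]]] := Ghat_generic gz' gw' O'.
(* As [-1/z] is an involution, it is enough to identify the inverted points, whose differences equal
   the even point [a - a']. *)
have := inv_inv_coord (generic_norm_gt0 gz).
have := inv_inv_coord (generic_norm_gt0 gz').
have := inv_inv_coord (generic_norm_gt0 gw).
have := inv_inv_coord (generic_norm_gt0 gw').
have := generic_inv gz.
move: OI OI'; cbv zeta.
set u := - x / _; set u1 := y / _; set v := - s / _; set v1 := t / _.
set u' := - x' / _; set u1' := y' / _; set v' := - s' / _; set v1' := t' / _.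
move=> OI OI' gu [s'E t'E] [sE tE] [x'E y'E] [xE yE] [e1 e2 e3 e4].
have ev2 : even_point (u - u') (u1 - u1').
  have -> : u - u' = a - a' by lra.
  have -> : u1 - u1' = b - b' by lra.
  exact: even_pointD ev (even_pointN ev').
have [||uE u1E] := inv_Omega_coord_translate_inj gu OI OI' ev2; [lra|lra|].
have vE : v = v' by lra.
have v1E : v1 = v1' by lra.
by rewrite -xE -yE -sE -tE uE u1E vE v1E x'E y'E s'E t'E.
Qed.

Lemma Ghat_surj : set_surj (Omega (R := R) `\` @nongeneric R)
  (Omega (R := R) `\` @nongeneric R) (@Ghat R).
Proof.
move=> p /OmegaD_generic[x [y [s [t [-> gz gw O]]]]].
have [a [b [ev OI]]] := Omega_coord_translate_surj gz gw O.
have gu := generic_even_translate ev gz.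
have gv := generic_even_translate ev gw.
have [uE u1E] := inv_inv_coord (generic_norm_gt0 gu).
have [vE v1E] := inv_inv_coord (generic_norm_gt0 gv).
have gz' := generic_inv gu; have gw' := generic_inv gv.
(* The preimage is [(-1/(z + a), -1/(w + a))]. [Ghat] inverts it and subtracts the nearest even
   point to [z + a], which is [a] because [z] is interior to [Kset]. *)
exists ((- (x + a) / ((x + a) ^+ 2 + (y + b) ^+ 2)) +i*
        ((y + b) / ((x + a) ^+ 2 + (y + b) ^+ 2)),
  Some ((- (s + a) / ((s + a) ^+ 2 + (t + b) ^+ 2)) +i*
        ((t + b) / ((s + a) ^+ 2 + (t + b) ^+ 2)))).
  apply: generic_OmegaD => //; apply/Omega_coord_inv; try exact: generic_norm_gt0.
  by rewrite uE u1E vE v1E.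
rewrite (@Ghat_complex _ _ _ _ a b) // uE u1E ?vE ?v1E ?addrK //.
apply: nearest_even_eq => // b1 b2; rewrite !addrK.
by case: O => + _ _; apply.
Qed.

End Sphere.

Theorem theorem4p4 (R : realType) :
  bijective_ae (@Ghat_dom R) (@Ghat R) (@Omega R).
Proof.
exists (@nongeneric R), (@nongeneric R).
split; [exact: nongeneric_null|exact: nongeneric_null| |split].
- move=> p /OmegaD_generic[x [y [s [t [-> gz _ O]]]]]; split=> //; split=> /=.
    exact: Omega_coord_Kset O.
  move=> [x0 y0]; have := generic_norm_gt0 gz.
  by rewrite x0 y0 expr0n /= addr0 ltxx.
- move=> p /OmegaD_generic[x [y [s [t [-> gz gw O]]]]].
  have [a [b [_ /= [-> _ [gz' gw'] O']]]] := Ghat_generic gz gw O.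
  exact: generic_OmegaD.
- exact: Ghat_inj.
- exact: Ghat_surj.
Qed.
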